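(* The observed process $\{S_t:t\in\mathbb{Z}^+\}$ of a discrete-time three-state hidden Markov model with 1-step transition probability matrix $P$ and state-dependent probability matrix $\Pi$ is irreversible if and only if the underlying Markov chain is irreversible, $\Pi$ is regular, and one of the following conditions is satisfied: 1) the rank of $\Pi$ is $3$; 2) the rank of $\Pi$ is $2$, and $0$ is not an eigenvalue of $P$.
   Context: Discrete-time three-state hidden Markov model: $\{C_t:t\in\mathbb{Z}^+\}$ (times $0,1,2,\dots$) is an irreducible, time-homogeneous Markov chain on $\{1,2,3\}$ with 1-step transition probability matrix $P=(p_{ij})$, started from its stationary distribution $\mu=(\mu_1,\mu_2,\mu_3)$, $\mu_i>0$, $\sum_i\mu_i=1$. The state-dependent probability matrix $\Pi=(\pi(k\,|\,i))$, $i=1,2,3$, $k=0,\dots,K-1$, is a $3\times K$ matrix with nonnegative entries and rows summing to 1; $\varphi_k\in\mathbb{R}^3$ is its column indexed by $k$. The observed process $\{S_t\}$ takes values in $\{0,\dots,K-1\}$; conditionally on the hidden state at time $t$, $S_t$ has law $\pi(\cdot\,|\,C_t)$ and is independent of all earlier observations and of the hidden chain before time $t$. Thus for integers $0\le t_1<\cdots<t_n$, $\Pr(S_{t_1}=s_1,\dots,S_{t_n}=s_n)=\mu\Lambda_{s_1}P^{t_2-t_1}\Lambda_{s_2}\cdots P^{t_n-t_{n-1}}\Lambda_{s_n}\vec e$, where $\Lambda_k=\mathrm{diag}(\varphi_k)$, $\vec e=(1,1,1)'$. The underlying chain is reversible if $\mu_ip_{ij}=\mu_jp_{ji}$ for all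 $i,j$, and irreversible otherwise. The observed process is reversible if for all positive integers $n$, all integers $0\le t_1\le\cdots\le t_n$ and all $s_1,\dots,s_n$, $\Pr(S_{t_1}=s_1,\dots,S_{t_n}=s_n)=\Pr(S_{t_1^-}=s_1,\dots,S_{t_n^-}=s_n)$ with $t_k^-=t_1+t_n-t_k$; otherwise it is irreversible. $\Pi$ is regular if no two of its three rows are equal as vectors; otherwise it is singular. *)

(* Defs.v *)
From HB Require Import structures.
From mathcomp Require Import all_boot all_order all_algebra.
From mathcomp Require Import all_classical all_reals all_analysis.

Set Implicit Arguments.
Unset Strict Implicit.
Unset Printing Implicit Defensive.

Import Order.TTheory GRing.Theory Num.Theory.

Local Open Scope classical_set_scope.
Local Open Scope ring_scope.

Definition stochastic (R : realType) (m n : nat) (A : 'M[R]_(m, n)) : Prop :=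
  (forall i j, 0 <= A i j) /\ (forall i, \sum_j A i j = 1).

Definition irreducible_chain (R : realType) (n : nat) (P : 'M[R]_n.+1) : Prop :=
  forall i j, exists k : nat, 0 < (P ^+ k) i j.

Definition positive_stationary (R : realType) (n : nat)
    (P : 'M[R]_n) (mu : 'rV[R]_n) : Prop :=
  [/\ forall i, 0 < mu 0 i, \sum_i mu 0 i = 1 & mu *m P = mu].

(* Measurability with respect to the discrete sigma-algebra on I. *)
Definition discrete_rv (d : measure_display) (T : measurableType d) (I : Type)
    (X : T -> I) : Prop :=
  forall A : set I, measurable (X @^-1` A).

(* Conditional probability Pr(A | B); meaningful only when Pr B != 0. *)
Definition cprob (d : measure_display) (T : measurableType d) (R : realType)
    (Pr : probability T R) (A B : set T) : R :=
  fine (Pr (A `&` B)) / fine (Pr B).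

(* The joint hidden and observed history strictly before time t. *)
Definition past (T I J : Type) (C : nat -> T -> I) (S : nat -> T -> J)
    (t : nat) (c : nat -> I) (s : nat -> J) : set T :=
  [set w | forall u : nat, (u < t)%N -> C u w = c u /\ S u w = s u].

(* The Markov property of C is stated relative to the joint history of C and S:
   the Markov property of C alone would still allow C (t + 1) to depend on S t,
   and would not determine the law of S. *)
Record hidden_markov_model (d : measure_display) (T : measurableType d)
    (R : realType) (Pr : probability T R) (K : nat)
    (P : 'M[R]_3) (mu : 'rV[R]_3) (Pi : 'M[R]_(3, K))
    (C : nat -> T -> 'I_3) (S : nat -> T -> 'I_K) : Prop := HiddenMarkovModel {
  hmm_transition_stochastic : stochastic P;
  hmm_irreducible : irreducible_chain P;
  hmm_stationary : positive_stationary P mu;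
  hmm_emission_stochastic : stochastic Pi;
  hmm_hidden_rv : forall t, discrete_rv (C t);
  hmm_observed_rv : forall t, discrete_rv (S t);
  hmm_initial : forall i, Pr [set w | C 0%N w = i] = (mu 0 i)%:E;
  hmm_transition : forall (t : nat) (c : nat -> 'I_3) (s : nat -> 'I_K) (j : 'I_3),
    Pr (past C S t.+1 c s) != 0%E ->
    cprob Pr [set w | C t.+1 w = j] (past C S t.+1 c s) = P (c t) j;
  hmm_emission : forall (t : nat) (c : nat -> 'I_3) (s : nat -> 'I_K) (k : 'I_K),
    Pr (past C S t c s `&` [set w | C t w = c t]) != 0%E ->
    cprob Pr [set w | S t w = k] (past C S t c s `&` [set w | C t w = c t])
      = Pi (c t) k
}.

Definition chain_reversible (R : realType) (n : nat)
    (P : 'M[R]_n) (mu : 'rV[R]_n) : Prop :=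
  forall i j, mu 0 i * P i j = mu 0 j * P j i.

(* The n.+1 observation times are t ord0 <= ... <= t ord_max, so the truncated
   subtraction below is exact. *)
Definition observed_reversible (d : measure_display) (T : measurableType d)
    (R : realType) (Pr : probability T R) (K : nat) (S : nat -> T -> 'I_K) : Prop :=
  forall (n : nat) (t : 'I_n.+1 -> nat) (s : 'I_n.+1 -> 'I_K),
    (forall i j : 'I_n.+1, (i <= j)%N -> (t i <= t j)%N) ->
    Pr [set w | forall k, S (t k) w = s k]
    = Pr [set w | forall k, S (t ord0 + t ord_max - t k)%N w = s k].

Definition regular_emission (R : realType) (m n : nat) (Pi : 'M[R]_(m, n)) : Prop :=
  forall i j, i != j -> row i Pi <> row j Pi.

(* Main.v *)
Require Import Defs.
From HB Require Import structures.
From mathcomp Require Import all_boot all_order all_algebra.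
From mathcomp Require Import all_classical all_reals all_analysis.
From mathcomp Require Import ring zify.

(** Write D = diag(mu), e for the all-ones column and Pt = D^-1 P^T D for the
    transition matrix of the time-reversed chain.  The law of the observed
    process is a family of numbers mu (diag(f_1) P) ... (diag(f_m) P) e, where
    each f_u collects the probabilities, given each hidden state, that the
    observation at time u lies in a prescribed set ([prob_window]); the set is
    a singleton at the times that are looked at and the whole alphabet at the
    others.  Reversing the word f_1 ... f_m amounts to replacing P by Pt
    ([word_rev]), so the question is when the words of emission vectors cannot
    tell P from Pt.

    They cannot in the following three cases, the last two of which are proved
    by carrying an invariant along the partial products computed with P and
    with Pt ([word_ind_rel]).
    - The chain is reversible: P = Pt.
    - Two rows of Pi agree.  Then the observations only see whether the hidden
      state is l, the remaining state; each visit to l cuts the trajectory into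
      independent pieces, and P and Pt have the same return probabilities to l
      ([word_singleton_reversible]).
    - Pi has rank 2 and P is singular.  Then P - e mu has rank at most 1, and
      all emission vectors lie in a plane spanned by e and one vector v.  A
      word expands into products of 2 x 2 matrices with entries
      mu diag(f) e, mu diag(f) x, y diag(f) e and y diag(f) x, where
      P - e mu = x y; reversal transposes these matrices, whose pair of
      off-diagonal entries is, for every f, a multiple of one fixed pair
      ([word_rank1_reversible]).
    In rank at most 1 all rows of Pi agree, as they sum to 1.

    Conversely let the observed process be reversible.  The antisymmetric
    matrix A = D P - P^T D has zero row sums, so for three states it is a
    multiple c of a fixed matrix.  In rank 3, the laws of two consecutive
    observations give Pi^T A Pi = 0, hence A = 0.  In rank 2 these laws carry
    no information, but those at times 0, a + 1, a + 2 for all a do: when P is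
    invertible, the Cayley-Hamilton theorem extrapolates them to a + 1 = 0
    ([antisymmetric_form_eq0]), as if the first two observations were
    made at the same time, independently given the hidden state.  This is
    (v v) A v^T = 0 with v v the entrywise square, and the left-hand side is c
    times the Vandermonde determinant of the entries of v, up to sign; they are
    distinct when Pi is regular ([vandermonde_reversible]). *)

Set Implicit Arguments.
Unset Strict Implicit.
Unset Printing Implicit Defensive.

Import Order.TTheory GRing.Theory Num.Theory.

Local Open Scope ring_scope.

(** * Words of emission vectors and time reversal *)

Section Words.
Variables (F : fieldType) (n : nat).
Implicit Types (P : 'M[F]_n.+1) (mu f : 'rV[F]_n.+1) (fs : seq 'rV[F]_n.+1).

Local Notation e := (const_mx 1 : 'cV[F]_n.+1).

(** Each letter f is the vector of likelihoods, given each hidden state, of the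
    event observed at one time step; the word is then mapped to the
    probability of these events at consecutive times. *)
Definition word P mu fs : F :=
  (mu *m \prod_(f <- fs) (diag_mx f * P) *m e) 0 0.

Definition time_reversal P mu : 'M[F]_n.+1 :=
  \matrix_(i, j) (mu 0 j * P j i / mu 0 i).

Definition stationary_chain P mu := P *m e = e /\ mu *m P = mu.

Lemma diag_mx_ones f : diag_mx f *m e = f^T.
Proof.
by apply/matrixP => i j; rewrite mul_diag_mx !mxE mulr1 (ord1 j).
Qed.

Lemma ones_diag_mx f : e^T *m diag_mx f = f.
Proof. by rewrite -[RHS]trmxK -diag_mx_ones trmx_mul tr_diag_mx. Qed.

Lemma mul_row_diagC f g : f *m diag_mx g = g *m diag_mx f.
Proof. by apply/rowP => i; rewrite !mul_mx_diag !mxE mulrC. Qed.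

Lemma mul_diagC f g : diag_mx f *m diag_mx g = diag_mx g *m diag_mx f.
Proof.
by rewrite !mulmx_diag; congr diag_mx; apply/rowP => i; rewrite !mxE mulrC.
Qed.

Lemma word_ones_prefix P mu m fs :
  mu *m P = mu -> word P mu (nseq m (const_mx 1) ++ fs) = word P mu fs.
Proof.
move=> muP; rewrite /word big_cat /= -mulmxE mulmxA; congr ((_ *m _ *m _) _ _).
rewrite big_nseq diag_const_mx mul1mx.
by elim: m => [|m IH] /=; rewrite ?mulmx1 // mulmxA muP.
Qed.

(** To compare two transition matrices on the words over V, it suffices to
    find a relation between the column vectors obtained by reading a word from
    its last letter which determines their products with mu. *)
Lemma word_ind_rel (P P' : 'M[F]_n.+1) mu (V : 'rV[F]_n.+1 -> Prop)
    (rel : 'cV[F]_n.+1 -> 'cV[F]_n.+1 -> Prop) :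
  rel e e -> (forall r r', rel r r' -> mu *m r = mu *m r') ->
  (forall f r r', V f -> rel r r' ->
     rel (diag_mx f *m (P *m r)) (diag_mx f *m (P' *m r'))) ->
  forall fs, (forall f, f \in fs -> V f) -> word P mu fs = word P' mu fs.
Proof.
move=> rel0 rel_mu relS fs Vfs; rewrite /word -!mulmxA.
suff /rel_mu-> : rel (\prod_(f <- fs) (diag_mx f * P) *m e)
                     (\prod_(f <- fs) (diag_mx f * P') *m e) by [].
elim: fs Vfs => [|f fs IH] Vfs; first by rewrite !big_nil !mul1mx.
rewrite !big_cons -![in rel _ _]mulmxE -!mulmxA; apply: relS.
  by apply: Vfs; rewrite inE eqxx.
by apply: IH => g gfs; apply: Vfs; rewrite inE gfs orbT.
Qed.

Section Reversal.
Variables (P : 'M[F]_n.+1) (mu : 'rV[F]_n.+1).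
Hypotheses (mu_neq0 : forall i, mu 0 i != 0) (statP : stationary_chain P mu).
Local Notation Pt := (time_reversal P mu).

(** Time reversal is the adjoint for the bilinear form of matrix diag(mu). *)
Lemma diag_time_reversal : diag_mx mu *m Pt = P^T *m diag_mx mu.
Proof.
apply/matrixP => i j; rewrite mul_diag_mx mul_mx_diag !mxE.
by rewrite mulrCA divff // mulr1 mulrC.
Qed.

Lemma diag_time_reversalX k :
  diag_mx mu *m Pt ^+ k = (P ^+ k)^T *m diag_mx mu.
Proof.
elim: k => [|k IH]; first by rewrite !expr0 trmx1 mul1mx mulmx1.
rewrite exprSr exprS -!mulmxE mulmxA IH trmx_mul -!mulmxA.
by rewrite diag_time_reversal.
Qed.

Lemma time_reversal_diagonal k i : (Pt ^+ k) i i = (P ^+ k) i i.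
Proof.
have /matrixP/(_ i i) := diag_time_reversalX k.
rewrite mul_diag_mx mul_mx_diag !mxE mulrC => h.
exact: (mulIf (mu_neq0 i)).
Qed.

Lemma mul_diag_mx_inj (p : nat) : injective (@mulmx F _ _ p (diag_mx mu)).
Proof.
move=> A B /matrixP AB; apply/matrixP => i j.
by have := AB i j; rewrite !mul_diag_mx !mxE; apply: mulfI.
Qed.

Lemma time_reversal_stationary : stationary_chain Pt mu.
Proof.
have [Pe muP] := statP; split; last first.
  rewrite -{1}(ones_diag_mx mu) -mulmxA diag_time_reversal mulmxA -trmx_mul Pe.
  exact: ones_diag_mx.
apply: mul_diag_mx_inj.
by rewrite mulmxA diag_time_reversal -mulmxA diag_mx_ones -trmx_mul muP.
Qed.

(** Transposition reverses the order of the factors and turns P into the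
    conjugate of its time reversal by diag(mu); the shift by one factor that
    remains is absorbed by mu and e, which are fixed by the reversed chain. *)
Lemma word_rev fs : word P mu (rev fs) = word Pt mu fs.
Proof.
have [Pte muPt] := time_reversal_stationary.
have shift : (\prod_(f <- fs) (Pt * diag_mx f)) *m Pt =
             Pt *m \prod_(f <- fs) (diag_mx f * Pt).
  elim: fs => [|f fs IH]; first by rewrite !big_nil mulmx1 mul1mx.
  by rewrite !big_cons -!mulmxE -mulmxA IH !mulmxA.
have tr : (\prod_(f <- rev fs) (diag_mx f * P))^T *m diag_mx mu =
          diag_mx mu *m \prod_(f <- fs) (Pt * diag_mx f).
  elim: fs {shift} => [|f fs IH].
    by rewrite !big_nil trmx1 mul1mx mulmx1.
  rewrite rev_cons -cats1 big_cat big_seq1 big_cons /= -!mulmxE.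
  rewrite !trmx_mul -!mulmxA IH tr_diag_mx !mulmxA diag_time_reversal.
  rewrite -!mulmxA; congr (_ *m _); rewrite !mulmxA; congr (_ *m _).
  exact: mul_diagC.
pose W := \prod_(f <- rev fs) (diag_mx f * P).
have -> : word P mu (rev fs) = (mu *m W *m e)^T 0 0 by rewrite mxE.
have -> : word Pt mu fs = (mu *m \prod_(f <- fs) (Pt * diag_mx f) *m e) 0 0.
  rewrite -[X in _ = (_ *m X) 0 0]Pte [in RHS]mulmxA -[in RHS](mulmxA mu).
  by rewrite shift !mulmxA muPt.
rewrite !trmx_mul -diag_mx_ones [X in _ *m X]mulmxA tr.
by rewrite !mulmxA ones_diag_mx.
Qed.

Lemma word_reversible fs :
  (forall i j, mu 0 i * P i j = mu 0 j * P j i) ->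
  word P mu (rev fs) = word P mu fs.
Proof.
move=> revP; rewrite word_rev; congr word; apply/matrixP => i j.
by rewrite mxE -revP mulrC mulKf.
Qed.

End Reversal.
End Words.

(** * Words that do not distinguish the chain from its reversal *)

Section Reversible.
Variables (F : fieldType) (n : nat) (P : 'M[F]_n.+1) (mu : 'rV[F]_n.+1).
Hypotheses (mu_neq0 : forall i, mu 0 i != 0) (statP : stationary_chain P mu).
Local Notation e := (const_mx 1 : 'cV[F]_n.+1).
Local Notation Pt := (time_reversal P mu).

(** The case of observations that only detect the state l.  The vectors r and r'
    of the invariant are related when they have the same product with mu and
    the same values at l after any number of steps.  The reason why it is
    preserved is that a letter a + b delta_l changes these numbers by
    return probabilities to l, which are insensitive to time reversal. *)
Lemma word_singleton_reversible l fs :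
  (forall f, f \in fs ->
     exists a b, diag_mx f = a%:M + b *: delta_mx l l) ->
  word P mu (rev fs) = word P mu fs.
Proof.
move=> Vfs; rewrite word_rev //; apply/esym; move: fs Vfs.
have [Pe muP] := statP.
have [Pte muPt] := time_reversal_stationary mu_neq0 statP.
have deltaE k (x : 'cV[F]_n.+1) (A : 'M[F]_(k, n.+1)) :
    A *m (delta_mx l l *m x) = x l 0 *: col l A.
  apply/matrixP => i j; rewrite !mxE (bigD1 l) //= big1 ?addr0.
    rewrite !mxE (bigD1 l) //= big1 ?addr0 => [|q ql].
      by rewrite !mxE !eqxx mul1r mulrC (ord1 j).
    by rewrite !mxE (negPf ql) andbF mul0r.
  move=> q ql; rewrite !mxE big1 ?mulr0 // => s _.
  by rewrite !mxE (negPf ql) mul0r.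
have PXe (Q : 'M[F]_n.+1) k : Q *m e = e -> Q ^+ k *m e = e.
  by move=> Qe; elim: k => [|k IH]; rewrite ?mul1mx // exprS -mulmxE -mulmxA IH.
apply: (word_ind_rel (rel := fun r r' => mu *m r = mu *m r' /\
  forall k, (P ^+ k *m r) l 0 = (Pt ^+ k *m r') l 0)).
- by split=> // k; rewrite !PXe.
- by move=> r r' [].
move=> f r r' [a [b ->]] [mur Pr]; have P1 := Pr 1%N; rewrite !expr1 in P1.
have stepE m (A : 'M[F]_(m, n.+1)) x :
    A *m ((a%:M + b *: delta_mx l l) *m x) =
    a *: (A *m x) + (b * x l 0) *: col l A.
  rewrite mulmxDl mulmxDr mul_scalar_mx -scalemxAl -!scalemxAr.
  by rewrite deltaE scalerA.
split=> [|k]; rewrite !stepE // P1.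
  by rewrite !mulmxA muP muPt mur.
rewrite !mulmxA !mulmxE -!exprSr mxE [RHS]mxE; congr (_ + _).
  by rewrite mxE Pr [RHS]mxE.
by rewrite !mxE time_reversal_diagonal.
Qed.

(** With N = P - e mu, the sandwich hypothesis says that N has rank at most 1.
    On top of equal products with mu, the invariant asks that v D N r
    and v N^T D r' agree, N^T D being D times the analogue of N for the
    reversed chain.  A letter a e + b v sends N r to a combination of v and of
    N r: the coefficient of the latter, read off the sandwich identity, is the
    same on both sides, and v D N v^T equals its transpose since it is a
    scalar. *)
Lemma word_rank1_reversible (v : 'rV[F]_n.+1) fs :
  (forall M, exists c,
     (P - e *m mu) *m M *m (P - e *m mu) = c *: (P - e *m mu)) ->
  mu *m e = 1 ->
  (forall f, f \in fs -> exists a b, f = const_mx a + b *: v) ->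
  word P mu (rev fs) = word P mu fs.
Proof.
set N := P - e *m mu => NMN mue Vfs; rewrite word_rev //; apply/esym.
move: fs Vfs.
have [Pe muP] := statP.
have [Pte muPt] := time_reversal_stationary mu_neq0 statP.
pose D := diag_mx mu; pose N' := Pt - e *m mu.
have DN' : D *m N' = N^T *m D.
  rewrite mulmxBr /D diag_time_reversal // mulmxA diag_mx_ones.
  by rewrite [N^T]linearB /= mulmxBl trmx_mul -mulmxA ones_diag_mx.
have Ne : N *m e = 0 by rewrite mulmxBl Pe -mulmxA mue mulmx1 subrr.
have muN : mu *m N = 0 by rewrite mulmxBr muP mulmxA mue mul1mx subrr.
have muN' : mu *m N' = 0 by rewrite mulmxBr muPt mulmxA mue mul1mx subrr.
have PrE (x : 'cV[F]_n.+1) : P *m x = e *m (mu *m x) + N *m x.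
  by rewrite mulmxBl mulmxA addrC subrK.
have PtrE (x : 'cV[F]_n.+1) : Pt *m x = e *m (mu *m x) + N' *m x.
  by rewrite mulmxBl mulmxA addrC subrK.
clearbody N N'.
have muDv (f : 'rV[F]_n.+1) : mu *m diag_mx f = f *m D := mul_row_diagC mu f.
apply: (word_ind_rel (rel := fun r r' => mu *m r = mu *m r' /\
  v *m D *m N *m r = v *m N^T *m D *m r')).
- split=> //; rewrite -!mulmxA Ne diag_mx_ones -trmx_mul muN.
  by rewrite trmx0 !mulmx0.
- by move=> r r' [].
move=> f r r' [a [b fE]] [mur Nr].
have [c NfN] := NMN (diag_mx f).
have fD : f *m D = a *: mu + b *: (v *m D).
  rewrite fE mulmxDl -scalemxAl; congr (_ + _).
  by apply/rowP => i; rewrite mul_mx_diag !mxE.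
rewrite PrE PtrE -mur; split.
  rewrite !mulmxDr !mulmxA muDv; congr (_ + _).
  rewrite fD !mulmxDl -!scalemxAl muN muN' !mul0mx !scaler0 !add0r.
  by rewrite Nr -(mulmxA v D N') DN' mulmxA.
rewrite !mulmxDr !mulmxA; congr (_ + _).
  congr (_ *m _ *m _); rewrite -!(mulmxA _ _ e) diag_mx_ones.
  have -> : v *m D *m N *m f^T = b *: (v *m D *m N *m v^T).
    rewrite fE linearD linearZ /= mulmxDr -scalemxAr.
    have -> : (const_mx a : 'rV[F]_n.+1)^T = a *: e.
      by apply/colP => i; rewrite !mxE mulr1.
    by rewrite -scalemxAr -(mulmxA _ N e) Ne mulmx0 scaler0 add0r.
  rewrite -[RHS]mulmxA -[D in RHS]tr_diag_mx -trmx_mul fD linearD !linearZ /=.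
  rewrite mulmxDr -!scalemxAr -(mulmxA v N^T mu^T) -trmx_mul muN.
  rewrite trmx0 mulmx0 scaler0 add0r; congr (_ *: _).
  rewrite trmx_mul tr_diag_mx !mulmxA -/D.
  (* Both sides are the same 1 x 1 matrix, up to transposition. *)
  set X := LHS; have -> : X = X^T.
    by apply/matrixP => i j; rewrite [RHS]mxE (ord1 i) (ord1 j).
  by rewrite !trmx_mul trmxK tr_diag_mx !mulmxA.
have DfN' : D *m diag_mx f *m N' = diag_mx f *m N^T *m D.
  rewrite -mulmxA -[RHS]mulmxA -DN' !mulmxA; congr (_ *m _).
  exact: mul_diagC.
transitivity (c *: (v *m D *m N *m r)).
  rewrite -(mulmxA (v *m D) N) -(mulmxA (v *m D) (N *m _)) NfN.
  by rewrite -scalemxAr -scalemxAl.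
have NfNt : N^T *m diag_mx f *m N^T = c *: N^T.
  by rewrite -[diag_mx f]tr_diag_mx -!trmx_mul mulmxA NfN linearZ.
rewrite -(mulmxA (v *m N^T) D) -(mulmxA (v *m N^T) (D *m _)) DfN'.
rewrite -(mulmxA v N^T) !(mulmxA N^T) NfNt -scalemxAl -scalemxAr -scalemxAl.
by rewrite Nr mulmxA.
Qed.

End Reversible.

Section RankOne.
Variables (F : fieldType).

(** If N = x y then N M N = x (y M x) y, and y M x is a scalar. *)
Lemma rank1_sandwich m n (N : 'M[F]_(m, n)) (M : 'M[F]_(n, m)) :
  (\rank N <= 1)%N -> exists c, N *m M *m N = c *: N.
Proof.
rewrite -{2 3 4}(mulmx_base N); move: (col_base N) (row_base N).
case: (\rank N) => [|[|//]] x y _.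
  by exists 0; rewrite thinmx0 !mul0mx scaler0.
exists ((y *m M *m x) 0 0).
rewrite -!mulmxA 2!(mulmxA y) (mulmxA (y *m M)) [y *m M *m x]mx11_scalar.
by rewrite mul_scalar_mx -scalemxAr !mxE.
Qed.

(** Both mu and a left null vector z of P are killed by P - e mu: the latter
    because z e = z P e = 0. They are independent as mu e = 1. *)
Lemma rank_sub_stationary n (P : 'M[F]_n.+1) (mu : 'rV[F]_n.+1) :
  stationary_chain P mu -> mu *m (const_mx 1 : 'cV_n.+1) = 1 ->
  eigenvalue P 0 ->
  (\rank (P - (const_mx 1 : 'cV_n.+1) *m mu)%R <= n.-1)%N.
Proof.
move=> [Pe muP] mue /eigenvalueP[z zP z0]; set e := const_mx 1 in Pe mue *.
rewrite scale0r in zP; set N := P - _.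
have ze : z *m e = 0 by rewrite -Pe mulmxA zP mul0mx.
have : (col_mx mu z <= kermx N)%MS.
  apply/sub_kermxP; rewrite mul_col_mx /N !mulmxBr muP zP !mulmxA mue ze.
  by rewrite mul1mx mul0mx !subrr col_mx0.
move/mxrankS; rewrite mxrank_ker.
suff -> : \rank (col_mx mu z) = 2%N by lia.
apply/eqP/inj_row_free => u.
rewrite -[u]hsubmxK mul_row_col; move: (lsubmx u) (rsubmx u) => a b abE.
have a0 : a = 0.
  move: (congr1 (mulmx^~ e) abE); rewrite mulmxDl -!mulmxA mue ze mulmx1.
  by rewrite mulmx0 addr0 mul0mx.
move: abE; rewrite a0 mul0mx add0r (mx11_scalar b) mul_scalar_mx => /eqP.
rewrite scaler_eq0 (negPf z0) orbF => /eqP->.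
by apply/rowP => j; rewrite !mxE; case: splitP => k _; rewrite !mxE ?mul0rn.
Qed.

End RankOne.

(** * Recovering reversibility of the chain from its words *)

Section SpacedWord.
Variables (F : fieldType) (n : nat).

(** The letter 1 stands for no observation. *)
Lemma word_triple (P : 'M[F]_n.+1) (mu v : 'rV[F]_n.+1) a :
  stationary_chain P mu ->
  word P mu ([:: v] ++ nseq a (const_mx 1) ++ [:: v; v]) =
  (v *m diag_mx mu *m P ^+ a.+1 *m (diag_mx v *m P *m v^T)) 0 0.
Proof.
move=> [Pe _]; rewrite /word !big_cat !big_cons !big_nil /= !mulr1.
have -> : \prod_(f <- nseq a (const_mx 1)) (diag_mx f * P) = P ^+ a.
  rewrite big_nseq; elim: a => //= a ->; rewrite exprS; congr (_ * _).
  by rewrite diag_const_mx -mulmxE mul1mx.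
rewrite exprS -!mulmxE -!mulmxA Pe diag_mx_ones !mulmxA.
by rewrite (mul_row_diagC mu v).
Qed.

End SpacedWord.

Section Converse.
Variables (F : fieldType) (n : nat) (P : 'M[F]_n.+1) (mu : 'rV[F]_n.+1).
Hypotheses (mu_neq0 : forall i, mu 0 i != 0) (statP : stationary_chain P mu).
Local Notation Pt := (time_reversal P mu).

Lemma word_pair f g : word P mu [:: f; g] = (f *m (diag_mx mu *m P) *m g^T) 0 0.
Proof.
have [Pe _] := statP.
rewrite /word !big_cons big_nil mulr1 -!mulmxE -!mulmxA Pe diag_mx_ones !mulmxA.
by rewrite (mul_row_diagC mu f).
Qed.

(** The joint law of two consecutive observations is the matrix
    Pi^T (diag(mu) P) Pi, and a right inverse of Pi recovers the matrix in the
    middle from it. *)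
Lemma rank_full_reversible (K : nat) (Pi : 'M[F]_(n.+1, K)) :
  row_free Pi ->
  (forall i j, word P mu [:: (col i Pi)^T; (col j Pi)^T] =
               word P mu [:: (col j Pi)^T; (col i Pi)^T]) ->
  forall i j, mu 0 i * P i j = mu 0 j * P j i.
Proof.
move=> /row_freeP[B PiB] sym.
pose A := diag_mx mu *m P; have tA : A^T = A.
  suff : Pi^T *m (A^T - A) *m Pi = 0.
    move/(congr1 (fun X => B^T *m X *m B)).
    rewrite !mulmxA -trmx_mul PiB trmx1 mul1mx -mulmxA PiB mulmx1.
    by rewrite mulmx0 mul0mx => /eqP; rewrite subr_eq0 => /eqP.
  rewrite mulmxBr mulmxBl; apply/eqP; rewrite subr_eq0.
  apply/eqP/matrixP => i j.
  have Aij (X : 'M[F]_n.+1) k l : (Pi^T *m X *m Pi) k l =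
     ((col k Pi)^T *m X *m col l Pi) 0 0.
    rewrite !mxE; apply: eq_bigr => s _; rewrite !mxE; congr (_ * _).
    by apply: eq_bigr => t _; rewrite !mxE.
  rewrite !Aij; move: (sym j i); rewrite !word_pair !trmxK -/A => <-.
  have tr00 (X : 'M[F]_1) : X 0 0 = X^T 0 0 by rewrite [RHS]mxE.
  by rewrite [LHS]tr00 !trmx_mul !trmxK mulmxA.
move=> i j; have /matrixP/(_ i j) := tA.
by rewrite mxE /A !mul_diag_mx !mxE.
Qed.

(** The hypothesis compares v D P^(a+1) diag(v) P v^T with the same expression
    for the reversed chain.  Both sequences satisfy the linear recurrence given
    by the characteristic polynomial of P, whose constant coefficient is
    nonzero; so they also agree at exponent 0. *)
Lemma antisymmetric_form_eq0 v :
  ~~ eigenvalue P 0 ->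
  (forall a, word P mu ([:: v] ++ nseq a (const_mx 1) ++ [:: v; v]) =
     word P mu (rev ([:: v] ++ nseq a (const_mx 1) ++ [:: v; v]))) ->
  let A := diag_mx mu *m P - P^T *m diag_mx mu in
  (v *m diag_mx v *m A *m v^T) 0 0 = 0.
Proof.
move=> P0 sym A; have statPt := time_reversal_stationary mu_neq0 statP.
pose D := diag_mx mu; pose w := diag_mx v *m P *m v^T.
pose w' := diag_mx v *m Pt *m v^T.
have symX a : (v *m D *m P ^+ a.+1 *m w) 0 0 = (v *m D *m Pt ^+ a.+1 *m w') 0 0.
  by rewrite -word_triple // -word_triple // -word_rev // revK sym.
suff : (v *m D *m w) 0 0 = (v *m D *m w') 0 0.
  rewrite /w /w' !mulmxA => vv.
  rewrite /A mulmxBr mulmxBl [LHS]mxE [X in _ + X]mxE.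
  apply/eqP; rewrite subr_eq0; apply/eqP.
  have comm : v *m diag_mx v *m D = v *m D *m diag_mx v.
    by rewrite -!mulmxA mul_diagC.
  by rewrite -diag_time_reversal // !mulmxA comm.
pose g k := (v *m D *m P ^+ k *m w - v *m D *m Pt ^+ k *m w') 0 0.
have gS k : g k.+1 = 0.
  by apply/eqP; rewrite /g [X in X == _]mxE [X in _ + X]mxE symX subrr.
suff : g 0%N = 0.
  rewrite /g !expr0 !mulmx1 [X in X = _ -> _]mxE [X in _ + X]mxE => /eqP.
  by rewrite subr_eq0 => /eqP.
pose q := char_poly P.
have qP : \sum_(i < size q) q`_i *: P ^+ i = 0.
  rewrite -[RHS](Cayley_Hamilton P) -/q -[in RHS](coefK q) poly_def linear_sum.
  by apply: eq_bigr => i _; rewrite linearZ rmorphXn /= horner_mx_X.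
have qPt : D *m (\sum_(i < size q) q`_i *: Pt ^+ i) = 0.
  have -> : D *m (\sum_(i < size q) q`_i *: Pt ^+ i) =
            (\sum_(i < size q) q`_i *: P ^+ i)^T *m D.
    rewrite [in RHS]linear_sum mulmx_sumr mulmx_suml; apply: eq_bigr => i _.
    by rewrite [in RHS]linearZ /= -scalemxAr -scalemxAl diag_time_reversalX.
  by rewrite qP trmx0 mul0mx.
have gq : \sum_(i < size q) q`_i * g i = 0.
  have -> : \sum_(i < size q) q`_i * g i =
     (v *m D *m (\sum_(i < size q) q`_i *: P ^+ i) *m w -
      v *m (D *m (\sum_(i < size q) q`_i *: Pt ^+ i)) *m w') 0 0.
    rewrite mulmxA !mulmx_sumr !mulmx_suml -sumrB summxE; apply: eq_bigr => i _.
    by rewrite -!scalemxAr -!scalemxAl -scalerBr mxE.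
  by rewrite qP qPt !mulmx0 !mul0mx subrr mxE.
have sz : (0 < size q)%N by rewrite size_char_poly.
move: gq; rewrite (bigD1 (Ordinal sz)) //= big1 ?addr0 => [/eqP|[[|i] ?] //= _].
  rewrite mulf_eq0 => /orP[q0|/eqP //].
  by case/negP: P0; rewrite eigenvalue_root_char /root -/q horner_coef0.
by rewrite gS mulr0.
Qed.

End Converse.

Lemma sum_ord3 (V : zmodType) (G : 'I_3 -> V) : \sum_i G i = G 0 + G 1 + G 2%:R.
Proof.
rewrite !big_ord_recl big_ord0 addr0 addrA.
by congr (G _ + G _ + G _); apply/val_inj.
Qed.

Lemma ord3_ind (Q : 'I_3 -> Prop) : Q 0 -> Q 1 -> Q 2%:R -> forall i, Q i.
Proof.
move=> Q0 Q1 Q2 [[|[|[|//]]] lt]; [move: Q0|move: Q1|move: Q2];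
by congr Q; apply/val_inj.
Qed.

(** A 3 x 3 antisymmetric matrix with zero row sums has entries
    a01 = a12 = a20 = c and the opposites. *)
Lemma vandermonde_reversible (F : fieldType) (P : 'M[F]_3) (mu v : 'rV[F]_3) :
  stationary_chain P mu -> injective (v 0) ->
  (v *m diag_mx v *m (diag_mx mu *m P - P^T *m diag_mx mu) *m v^T) 0 0 = 0 ->
  forall i j, mu 0 i * P i j = mu 0 j * P j i.
Proof.
move=> [/matrixP Pe /matrixP muP] v_inj; set A := _ - _ => vAv.
pose a i j := mu 0 i * P i j - mu 0 j * P j i.
have AE i j : A i j = a i j.
  by rewrite /A mul_diag_mx mul_mx_diag !mxE [P j i * _]mulrC.
have a_row i : a i 0 + a i 1 + a i 2%:R = 0.
  rewrite -sum_ord3 sumrB -mulr_sumr.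
  move: (Pe i 0) (muP 0 i); rewrite !mxE => Pi1 ->.
  suff -> : \sum_j P i j = 1 by rewrite mulr1 subrr.
  by rewrite -Pi1; apply: eq_bigr => j _; rewrite !mxE mulr1.
have a_anti i j : a j i = - a i j by rewrite opprB.
have a_diag i : a i i = 0 by rewrite /a subrr.
set c := a 0 1.
have a02 : a 0 2%:R = - c.
  by apply/eqP; rewrite -addr_eq0 addrC -(a_row 0) a_diag add0r.
have a12 : a 1 2%:R = c.
  by apply/eqP; rewrite -subr_eq0 -(a_row 1) a_diag addr0 (a_anti 0 1) addrC.
(* The form is c times the Vandermonde determinant, up to sign. *)
have c0 : c = 0.
  move: vAv; rewrite mxE sum_ord3 !mxE !sum_ord3 !AE !mul_mx_diag !mxE.
  rewrite !a_diag (a_anti 0 1) (a_anti 0 2%:R) (a_anti 1 2%:R) a02 a12 -/c.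
  set x := v 0 0; set y := v 0 1; set z := v 0 2%:R => h.
  have /eqP : c * (x - y) * (y - z) * (x - z) = 0 by rewrite -h; ring.
  have neq (i j : 'I_3) : i != j -> v 0 i - v 0 j != 0.
    by move=> ij; rewrite subr_eq0; apply: contraNneq ij => /v_inj->.
  by rewrite !mulf_eq0 !(negPf (neq _ _ _)) // !orbF => /eqP.
suff a0 : forall i j, a i j = 0
  by move=> i j; apply/eqP; rewrite -subr_eq0 -/(a i j) a0.
apply: ord3_ind; apply: ord3_ind; rewrite ?a_diag //;
  rewrite ?(a_anti 0 1) ?(a_anti 0 2%:R) ?(a_anti 1 2%:R);
  rewrite ?a02 ?a12 -?/c ?c0 ?oppr0 //.
Qed.

(** * Emission vectors *)

Section Emission.
Variables (R : realType) (n K : nat) (Pi : 'M[R]_(n.+1, K)).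
Hypothesis stoPi : stochastic Pi.

Definition emission (Q : pred 'I_K) : 'rV[R]_n.+1 :=
  \row_i \sum_(k | Q k) Pi i k.

Lemma emission1 k : emission (pred1 k) = (col k Pi)^T.
Proof. by apply/rowP => i; rewrite !mxE big_pred1_eq. Qed.

Lemma emissionT : emission predT = const_mx 1.
Proof. by apply/rowP => i; rewrite !mxE (stoPi.2 i). Qed.

Lemma emission_sub Q : (emission Q <= Pi^T)%MS.
Proof.
apply/submxP; exists (\row_k (Q k)%:R); apply/rowP => i.
rewrite !mxE big_mkcond; apply: eq_bigr => k _; rewrite !mxE.
by case: (Q k); rewrite ?mul1r ?mul0r.
Qed.

Lemma ones_sub : ((const_mx 1 : 'rV_n.+1) <= Pi^T)%MS.
Proof. by rewrite -emissionT emission_sub. Qed.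

Lemma rank_ones : \rank (const_mx 1 : 'rV[R]_n.+1) = 1%N.
Proof.
rewrite rank_rV; case: eqP => // /rowP/(_ 0); rewrite !mxE => /eqP.
by rewrite oner_eq0.
Qed.

(** The span of the columns of Pi contains e, so it is the line of e. *)
Lemma rank1_singular : (\rank Pi <= 1)%N -> forall i j, row i Pi = row j Pi.
Proof.
move=> rk i j; have sub : (Pi^T <= (const_mx 1 : 'rV[R]_n.+1))%MS.
  by rewrite -(geq_leqif (mxrank_leqif_sup ones_sub)) mxrank_tr rank_ones.
apply/rowP => k; rewrite !mxE.
have /sub_rVP[c] := submx_trans (row_sub k Pi^T) sub.
by move=> /rowP h; move: (h i) (h j); rewrite !mxE => -> ->.
Qed.

(** The second vector spanning the plane of emission vectors can be taken to be
    a column of Pi, which makes it the emission vector of a single symbol. *)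
Lemma rank2_span : \rank Pi = 2%N -> exists k, forall Q, exists a b,
  emission Q = const_mx a + b *: (col k Pi)^T.
Proof.
move=> rk; set u : 'rV[R]_n.+1 := const_mx 1.
have [k uk] : exists k, ~~ (row k Pi^T <= u)%MS.
  apply/existsP; rewrite -negb_forall; apply/negP => /forallP/= h.
  by have /mxrankS := introT row_subP h; rewrite mxrank_tr rk rank_ones.
exists k => Q.
have le : (u + row k Pi^T <= Pi^T)%MS by rewrite addsmx_sub ones_sub row_sub.
have : (Pi^T <= u + row k Pi^T)%MS.
  rewrite -(geq_leqif (mxrank_leqif_sup le)) mxrank_tr rk.
  have rk_u : \rank u = 1%N := rank_ones.
  rewrite -[X in (X.+1 <= _)%N]rk_u ltnNge.
  rewrite (geq_leqif (mxrank_leqif_sup (addsmxSl u (row k Pi^T)))).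
  by rewrite addsmx_sub submx_refl.
move/(submx_trans (emission_sub Q))/sub_addsmxP => [[x y]] /= ->.
exists (x 0 0), (y 0 0); rewrite (mx11_scalar x) (mx11_scalar y) !mul_scalar_mx.
by rewrite tr_col !mxE; congr (_ + _); apply/rowP => i; rewrite !mxE mulr1.
Qed.

End Emission.

(** The three elements of 'I_3, read modulo 3, have sum zero: so the state that
    differs from both i and j is - (i + j). *)
Lemma third_state (i j x : 'I_3) :
  i != j -> x != - (i + j) -> (x == i) || (x == j).
Proof. by move: i j x; do 3!apply: ord3_ind. Qed.

Lemma singular_emission (R : realType) K (Pi : 'M[R]_(3, K)) i j Q :
  i != j -> row i Pi = row j Pi ->
  exists a b, diag_mx (emission Pi Q) =
    a%:M + b *: delta_mx (- (i + j)) (- (i + j)).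
Proof.
move=> ij /rowP Pij; set f := emission _ _; set l := - _.
have fij : f 0 i = f 0 j.
  by rewrite !mxE; apply: eq_bigr => k _; have := Pij k; rewrite !mxE.
clearbody f; exists (f 0 i), (f 0 l - f 0 i).
apply/matrixP => x y; rewrite !mxE.
have [<-|xy] := eqVneq x y; last first.
  by rewrite mulr0n; case: eqP => [xl|]; case: eqP => [yl|];
     rewrite ?mulr0 ?addr0 //; move: xy; rewrite xl yl eqxx.
rewrite andbb !mulr1n; have [->|/(third_state ij)] := eqVneq x l.
  by rewrite mulr1 addrC subrK.
by case/orP => /eqP ->; rewrite mulr0 addr0 ?fij.
Qed.

Local Open Scope classical_set_scope.

(** * Events determined by finitely many discrete random variables *)

Section FiniteProb.
Variables (d : measure_display) (T : measurableType d) (R : realType).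
Variable (Pr : probability T R).

Definition prob (A : set T) : R := fine (Pr A).

Lemma probE A : measurable A -> Pr A = (prob A)%:E.
Proof. by move=> mA; rewrite fineK // fin_num_measure. Qed.

Lemma prob_sum (I : finType) (X : T -> I) (A : set T) :
  discrete_rv X -> measurable A ->
  prob A = \sum_x prob (A `&` X @^-1` [set x]).
Proof.
move=> mX mA; apply: EFin_inj; rewrite -probE // -sumEFin.
have AE : A = \bigcup_(x in [set: I]) (A `&` X @^-1` [set x]).
  rewrite -setI_bigcupr -preimage_bigcup.
  by apply/seteqP; split => [w Aw|w []//]; split=> //=; exists (X w).
rewrite {1}AE measure_fin_bigcup; last 3 first.
- exact: finite_finset.
- by apply: trivIset_setIl; exact: trivIset_preimage1.
- by move=> x _; apply: measurableI => //; apply: mX.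
rewrite (fsbigE (index_enum I)) ?index_enum_uniq //.
- rewrite [LHS]big_mkcond; apply: eq_bigr => x _.
  rewrite in_setT; apply: probE; apply: measurableI => //; apply: mX.
- by move=> x _; rewrite mem_index_enum.
Qed.

Lemma discrete_rv_fin (I : finType) (X : T -> I) :
  (forall x, measurable (X @^-1` [set x])) -> discrete_rv X.
Proof.
move=> mX A; rewrite (_ : A = \bigcup_(x in A) [set x]).
  rewrite preimage_bigcup; apply: fin_bigcup_measurable.
    exact: finite_finset.
  by move=> x _; apply: mX.
by apply/seteqP; split=> [x Ax|x [y Ay ->]//]; exists x.
Qed.

Lemma discrete_rv_pair (I J : finType) (X : T -> I) (Y : T -> J) :
  discrete_rv X -> discrete_rv Y -> discrete_rv (fun w => (X w, Y w)).
Proof.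
move=> mX mY; apply: discrete_rv_fin => -[x y].
rewrite (_ : _ @^-1` _ = X @^-1` [set x] `&` Y @^-1` [set y]).
  by apply: measurableI; [apply: mX|apply: mY].
by apply/seteqP; split => [w [<- <-]|w [/= -> ->]].
Qed.

Lemma discrete_rv_ffun (U I : finType) (X : U -> T -> I) :
  (forall u, discrete_rv (X u)) -> discrete_rv (fun w => [ffun u => X u w]).
Proof.
move=> mX; apply: discrete_rv_fin => h.
rewrite (_ : _ @^-1` _ = \bigcap_(u in [set: U]) (X u @^-1` [set h u])).
  apply: fin_bigcap_measurable; first exact: finite_finset.
  by move=> u _; apply: mX.
apply/seteqP; split => [w /= <- u _|w hw]; first by rewrite /= ffunE.
by apply/ffunP => u; rewrite ffunE; apply: hw.
Qed.

(** A conditional probability that is constant over the nonempty fibres of X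
    contained in the event X \in G is also the conditional probability given
    this event.  The hypothesis is indexed by points w rather than by values of
    X so that it says nothing about empty fibres. *)
Lemma prob_mul_saturated (I : finType) (X : T -> I) (G : set I) (A : set T) p :
  discrete_rv X -> measurable A ->
  (forall w, G (X w) ->
     prob (A `&` X @^-1` [set X w]) = p * prob (X @^-1` [set X w])) ->
  prob (A `&` X @^-1` G) = p * prob (X @^-1` G).
Proof.
move=> mX mA hG.
rewrite (prob_sum mX (measurableI _ _ mA (mX G))) (prob_sum mX (mX G)).
rewrite mulr_sumr; apply: eq_bigr => x _.
have [[w [Gw xw]]|none] := pselect (exists w, G (X w) /\ X w = x).
  have -> : X @^-1` G `&` X @^-1` [set x] = X @^-1` [set x].
    by apply/setIidPr => u /= ->; rewrite -xw.
  rewrite -setIA; have -> : X @^-1` G `&` X @^-1` [set x] = X @^-1` [set x].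
    by apply/setIidPr => u /= ->; rewrite -xw.
  by rewrite -xw hG.
have -> : A `&` X @^-1` G `&` X @^-1` [set x] = set0.
  by apply/seteqP; split=> // w [[_ Gw] xw]; apply: none; exists w.
have -> : X @^-1` G `&` X @^-1` [set x] = set0.
  by apply/seteqP; split=> // w [Gw xw]; apply: none; exists w.
by rewrite /prob measure0 mulr0.
Qed.

Lemma cprob_mul (A B : set T) p : measurable A -> measurable B ->
  (Pr B != 0%E -> cprob Pr A B = p) -> prob (A `&` B) = p * prob B.
Proof.
move=> mA mB; have [B0 _|nz /(_ isT) <-] := eqVneq (Pr B) 0%E; last first.
  rewrite /cprob -/(prob _) -/(prob _) divfK // /prob.
  by rewrite fine_eq0 // fin_num_measure.
have : (Pr (A `&` B) <= Pr B)%E.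
  by apply: le_measure; rewrite ?inE //; apply: measurableI.
rewrite B0 /prob B0 mulr0 => le0; suff -> : Pr (A `&` B) = 0%E by [].
by apply/eqP; rewrite eq_le le0 measure_ge0.
Qed.

End FiniteProb.

(** * The law of the observed process *)

Section Law.
Variables (d : measure_display) (T : measurableType d) (R : realType)
    (Pr : probability T R) (K : nat)
    (P : 'M[R]_3) (mu : 'rV[R]_3) (Pi : 'M[R]_(3, K))
    (C : nat -> T -> 'I_3) (S : nat -> T -> 'I_K).
Hypothesis hmm : hidden_markov_model Pr P mu Pi C S.
Local Notation prob := (prob Pr).

Definition history t w : {ffun 'I_t -> 'I_3 * 'I_K} :=
  [ffun u : 'I_t => (C u w, S u w)].

Lemma discrete_rv_history t : discrete_rv (history t).
Proof.
apply: discrete_rv_ffun => u; apply: discrete_rv_pair.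
  exact: (hmm_hidden_rv hmm).
exact: (hmm_observed_rv hmm).
Qed.

Lemma history_fiber t w :
  history t @^-1` [set history t w] = past C S t (C ^~ w) (S ^~ w).
Proof.
apply/seteqP; split=> [v /= /ffunP h u ut|v h /=].
  by have := h (Ordinal ut); rewrite !ffunE /= => -[-> ->].
by apply/ffunP => u; rewrite !ffunE; have [-> ->] := h u (ltn_ord u).
Qed.

Definition observed_in (Q : nat -> pred 'I_K) t : set T :=
  [set w | forall u, (u < t)%N -> Q u (S u w)].

Lemma observed_in_history Q t : observed_in Q t =
  history t @^-1` [set h | forall u : 'I_t, Q u (h u).2].
Proof.
apply/seteqP; split=> [w Qw u /=|w Qw u ut]; first by rewrite ffunE; apply: Qw.
by have := Qw (Ordinal ut); rewrite ffunE.
Qed.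

Lemma measurable_observed_in Q t : measurable (observed_in Q t).
Proof. by rewrite observed_in_history; apply: discrete_rv_history. Qed.

Lemma prob_transition Q t i j :
  prob (C t.+1 @^-1` [set j] `&` (observed_in Q t.+1 `&` C t @^-1` [set i])) =
  P i j * prob (observed_in Q t.+1 `&` C t @^-1` [set i]).
Proof.
have -> : observed_in Q t.+1 `&` C t @^-1` [set i] = history t.+1 @^-1`
    [set h | (forall u : 'I_t.+1, Q u (h u).2) /\ (h ord_max).1 = i].
  rewrite observed_in_history; apply/seteqP.
  by split=> w /= -[Qw <-]; split=> //; rewrite ffunE.
have mC := hmm_hidden_rv hmm t.+1 [set j].
apply: prob_mul_saturated => //; first exact: discrete_rv_history.
move=> w [_]; rewrite ffunE /= => <-.
apply: cprob_mul => //; first exact: discrete_rv_history.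
rewrite history_fiber => nz; exact: (hmm_transition hmm).
Qed.

Lemma prob_emission Q t i k :
  prob (S t @^-1` [set k] `&` (observed_in Q t `&` C t @^-1` [set i])) =
  Pi i k * prob (observed_in Q t `&` C t @^-1` [set i]).
Proof.
(* The emission property conditions on C t together with the strict past. *)
pose X w := (history t w, C t w).
have mX : discrete_rv X.
  apply: discrete_rv_pair; first exact: discrete_rv_history.
  exact: (hmm_hidden_rv hmm).
have -> : observed_in Q t `&` C t @^-1` [set i] =
    X @^-1` [set h : {ffun 'I_t -> 'I_3 * 'I_K} * 'I_3 |
      (forall u : 'I_t, Q u (h.1 u).2) /\ h.2 = i].
  by rewrite observed_in_history; apply/seteqP; split=> w /= -[Qw <-].
have mS := hmm_observed_rv hmm t [set k].
apply: prob_mul_saturated => // w [_ /= <-].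
apply: cprob_mul => //.
have -> : X @^-1` [set X w] =
    past C S t (C ^~ w) (S ^~ w) `&` [set v | C t v = C t w].
  rewrite -history_fiber; apply/seteqP.
  by split=> [v [] //|v [/= h c]]; congr pair.
move=> nz; exact: (hmm_emission hmm (c := C ^~ w)).
Qed.

(** The forward algorithm of hidden Markov models: one time step weights the
    current state by the likelihood of the observation, then moves it by P. *)
Lemma forward_probability Q t j :
  prob (observed_in Q t `&` C t @^-1` [set j]) =
  (mu *m \prod_(0 <= u < t) (diag_mx (emission Pi (Q u)) * P)) 0 j.
Proof.
elim: t j => [|t IH] j.
  rewrite big_nil mulmx1 /prob (_ : _ `&` _ = [set w | C 0%N w = j]).
    by rewrite (hmm_initial hmm).
  by apply/seteqP; split=> [w []|w].
rewrite big_nat_recr //= -!mulmxE !mulmxA mxE.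
have mC u x := hmm_hidden_rv hmm u [set x].
have mO := measurable_observed_in Q.
rewrite (prob_sum Pr (hmm_hidden_rv hmm t)); last by apply: measurableI.
apply: eq_bigr => i _.
rewrite mul_mx_diag [X in _ = X * _]mxE -IH [emission _ _ _ _]mxE.
rewrite (setIC (observed_in _ _)) -setIA prob_transition mulrC; congr (_ * _).
rewrite (prob_sum Pr (hmm_observed_rv hmm t)); last by apply: measurableI.
rewrite mulr_sumr [RHS]big_mkcond; apply: eq_bigr => k _.
case: ifPn => Qk.
  rewrite mulrC -prob_emission; congr prob; rewrite setIC.
  apply/seteqP; split=> w /= [Sk [Qw Ci]]; split=> //; split=> // u.
    by move=> ut; apply: Qw; apply: leqW.
  by rewrite ltnS leq_eqVlt => /orP[/eqP->|/Qw//]; rewrite Sk.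
rewrite /prob (_ : _ `&` _ = set0) ?measure0 //.
apply/seteqP; split=> // w /= [[Qw _] Sk].
by move: Qk; rewrite -Sk Qw.
Qed.

Lemma prob_observed_in Q t :
  prob (observed_in Q t) = word P mu [seq emission Pi (Q u) | u <- iota 0 t].
Proof.
rewrite (prob_sum Pr (hmm_hidden_rv hmm t)); last exact: measurable_observed_in.
rewrite /word mxE big_map; apply: eq_bigr => i _.
by rewrite forward_probability !mxE mulr1 /index_iota subn0.
Qed.

(** Contradictory values at a repeated time give the empty constraint and a time
    that is not observed gives the trivial one, so that neither situation needs
    a separate treatment. *)
Definition constraint n (t : 'I_n.+1 -> nat) (s : 'I_n.+1 -> 'I_K) u :
  pred 'I_K :=
  fun k => [forall j, (t j == u) ==> (s j == k)].

Definition window_word n t s a N :=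
  [seq emission Pi (@constraint n t s u) | u <- iota a N].

(** The letters before time a are equal to 1 and stationarity removes them: this
    is what makes the law invariant under shifts of the window. *)
Lemma prob_window n (t : 'I_n.+1 -> nat) s a N :
  (forall j, (a <= t j < a + N)%N) ->
  Pr [set w | forall j, S (t j) w = s j] = (word P mu (window_word t s a N))%:E.
Proof.
move=> tN.
have -> : [set w | forall j, S (t j) w = s j] =
          observed_in (constraint t s) (a + N).
  apply/seteqP; split=> w Sw => [u _|j].
    by apply/forallP => j; apply/implyP => /eqP <-; rewrite Sw.
  have /andP[_ tj] := tN j; have /forallP/(_ j) := Sw _ tj.
  by rewrite eqxx => /eqP.
rewrite probE; last exact: measurable_observed_in.
rewrite prob_observed_in iotaD map_cat add0n.
have -> : [seq emission Pi (constraint t s u) | u <- iota 0 a] =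
          nseq a (const_mx 1).
  apply: (@eq_from_nth _ 0) => [|u];
    rewrite size_map size_iota ?size_nseq // => ua.
  rewrite (nth_map 0%N) ?size_iota // nth_iota // add0n nth_nseq ua.
  rewrite -(emissionT (hmm_emission_stochastic hmm)).
  apply/rowP => i; rewrite !mxE; apply: eq_bigl => k; apply/forallP => j.
  apply/implyP => /eqP tj; have /andP[] := tN j.
  by rewrite tj leqNgt ua.
have [_ _ muP] := hmm_stationary hmm.
by rewrite word_ones_prefix.
Qed.

Lemma window_word_rev n (t : 'I_n.+1 -> nat) s a N :
  (forall j, (a <= t j < a + N.+1)%N) ->
  window_word (fun k => a + (a + N) - t k)%N s a N.+1 =
  rev (window_word t s a N.+1).
Proof.
move=> tN; apply: (@eq_from_nth _ 0) => [|u].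
  by rewrite size_rev !size_map !size_iota.
rewrite size_map size_iota ltnS => uN.
rewrite nth_rev size_map size_iota ?ltnS // subSS.
rewrite !(nth_map 0%N) ?size_iota ?ltnS ?leq_subr //.
rewrite !nth_iota ?ltnS ?leq_subr //.
apply/rowP => i; rewrite !mxE; apply: eq_bigl => k.
apply: eq_forallb => j; congr (_ ==> _).
by apply/idP/idP => /eqP; have := tN j; lia.
Qed.

Lemma observed_reversibleP :
  observed_reversible Pr S <->
  forall n (t : 'I_n.+1 -> nat) (s : 'I_n.+1 -> 'I_K),
    (forall i j : 'I_n.+1, (i <= j)%N -> (t i <= t j)%N) ->
    let fs := window_word t s (t ord0) (t ord_max - t ord0).+1 in
    word P mu fs = word P mu (rev fs).
Proof.
have key n (t : 'I_n.+1 -> nat) (s : 'I_n.+1 -> 'I_K) :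
    (forall i j : 'I_n.+1, (i <= j)%N -> (t i <= t j)%N) ->
    let fs := window_word t s (t ord0) (t ord_max - t ord0).+1 in
    Pr [set w | forall k, S (t k) w = s k] = (word P mu fs)%:E /\
    Pr [set w | forall k, S (t ord0 + t ord_max - t k)%N w = s k] =
      (word P mu (rev fs))%:E.
  move=> tmon fs; have t0 j := tmon ord0 j (leq0n _).
  have tm j := tmon j ord_max (leq_ord j).
  have tN j : (t ord0 <= t j < t ord0 + (t ord_max - t ord0).+1)%N.
    by have := t0 j; have := tm j; lia.
  split; first exact: prob_window.
  rewrite /fs -window_word_rev // -prob_window => [|j].
    by rewrite subnKC.
  by have := tN j; lia.
split=> rev_eq n t s tmon; have [Ef Er] := key n t s tmon.
  by apply: EFin_inj; rewrite -Ef -Er; apply: rev_eq.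
by rewrite Ef Er rev_eq.
Qed.

End Law.

(** * Reversibility of the observed process *)

Section Main.
Variables (d : measure_display) (T : measurableType d) (R : realType)
    (Pr : probability T R) (K : nat)
    (P : 'M[R]_3) (mu : 'rV[R]_3) (Pi : 'M[R]_(3, K))
    (C : nat -> T -> 'I_3) (S : nat -> T -> 'I_K).
Hypothesis hmm : hidden_markov_model Pr P mu Pi C S.

Lemma hmm_mu_neq0 i : mu 0 i != 0.
Proof. by have [mu_gt0 _ _] := hmm_stationary hmm; rewrite gt_eqF. Qed.

Lemma hmm_chain : stationary_chain P mu.
Proof.
have [_ _ muP] := hmm_stationary hmm; split=> //.
apply/colP => i; rewrite !mxE -[RHS]((hmm_transition_stochastic hmm).2 i).
by apply: eq_bigr => j _; rewrite mxE mulr1.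
Qed.

Lemma hmm_mu_ones : mu *m (const_mx 1 : 'cV_3) = 1.
Proof.
have [_ mu1 _] := hmm_stationary hmm.
apply/matrixP => i j; rewrite !ord1 !mxE -[RHS]mu1.
by apply: eq_bigr => k _; rewrite mxE mulr1.
Qed.

Lemma observed_reversible_words (V : 'rV[R]_3 -> Prop) :
  (forall Q, V (emission Pi Q)) ->
  (forall fs, (forall f, f \in fs -> V f) ->
     word P mu (rev fs) = word P mu fs) ->
  observed_reversible Pr S.
Proof.
move=> VQ Vrev; apply/(observed_reversibleP hmm) => n t s _ fs.
by rewrite Vrev // => f /mapP[u _ ->].
Qed.

Lemma observed_reversible_chain :
  chain_reversible P mu -> observed_reversible Pr S.
Proof.
move=> rev; apply: (@observed_reversible_words xpredT) => // fs _.
by apply: word_reversible => //; [exact: hmm_mu_neq0|exact: hmm_chain].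
Qed.

Lemma observed_reversible_singular i j :
  i != j -> row i Pi = row j Pi -> observed_reversible Pr S.
Proof.
move=> ij rows; apply: (@observed_reversible_words (fun f => exists a b,
  diag_mx f = a%:M + b *: delta_mx (- (i + j)) (- (i + j)))).
  by move=> Q; apply: singular_emission.
move=> fs; apply: word_singleton_reversible.
  exact: hmm_mu_neq0.
exact: hmm_chain.
Qed.

Lemma observed_reversible_eigen0 :
  \rank Pi = 2%N -> eigenvalue P 0 -> observed_reversible Pr S.
Proof.
move=> rk P0; have [k span] := rank2_span (hmm_emission_stochastic hmm) rk.
apply: (@observed_reversible_words (fun f => exists a b,
  f = const_mx a + b *: (col k Pi)^T)) => // fs.
apply: word_rank1_reversible.
- exact: hmm_mu_neq0.
- exact: hmm_chain.
- move=> M; apply: rank1_sandwich; apply: rank_sub_stationary => //.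
    exact: hmm_chain.
  exact: hmm_mu_ones.
- exact: hmm_mu_ones.
Qed.

Lemma emission_constraint n (t : 'I_n.+1 -> nat) (s : 'I_n.+1 -> 'I_K) j :
  (forall j', t j' = t j -> s j' = s j) ->
  emission Pi (constraint t s (t j)) = (col (s j) Pi)^T.
Proof.
move=> tj; rewrite -emission1; apply/rowP => i; rewrite !mxE.
apply: eq_bigl => k; apply/forallP/eqP => [/(_ j)|->{k} j'].
  by rewrite eqxx => /eqP.
by apply/implyP => /eqP/tj->.
Qed.

Lemma emission_unconstrained n (t : 'I_n.+1 -> nat) (s : 'I_n.+1 -> 'I_K) u :
  (forall j, t j != u) -> emission Pi (constraint t s u) = const_mx 1.
Proof.
move=> tu; rewrite -(emissionT (hmm_emission_stochastic hmm)).
apply/rowP => i; rewrite !mxE; apply: eq_bigl => k; apply/forallP => j.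
by rewrite (negPf (tu j)).
Qed.

Lemma chain_reversible_rank3 :
  \rank Pi = 3%N -> observed_reversible Pr S -> chain_reversible P mu.
Proof.
move=> rk /(observed_reversibleP hmm) obs.
apply: (rank_full_reversible hmm_chain (Pi := Pi)).
  by rewrite /row_free rk.
move=> i j; pose s (k : 'I_2) := if k == 0 then i else j.
have := obs 1%N (@nat_of_ord 2) s (fun _ _ => id) => /=.
rewrite /window_word /=.
rewrite -[0%N]/(nat_of_ord (0 : 'I_2)) -[1%N]/(nat_of_ord (1 : 'I_2)).
by rewrite !emission_constraint // => j' /val_inj ->.
Qed.

Lemma chain_reversible_rank2 :
  \rank Pi = 2%N -> regular_emission Pi -> ~~ eigenvalue P 0 ->
  observed_reversible Pr S -> chain_reversible P mu.
Proof.
move=> rk reg P0 /(observed_reversibleP hmm) obs.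
have [k span] := rank2_span (hmm_emission_stochastic hmm) rk.
apply: (vandermonde_reversible hmm_chain (v := (col k Pi)^T)).
  move=> i j kij; apply/eqP/negPn/negP => /reg; apply; apply/rowP => l.
  have [a [b]] := span (pred1 l); rewrite emission1 => /rowP lE.
  by move: kij (lE i) (lE j); rewrite !mxE => -> -> ->.
apply: (antisymmetric_form_eq0 hmm_mu_neq0 hmm_chain P0) => a.
(* The observation times are 0, a + 1 and a + 2, all with the symbol k. *)
pose t (j : 'I_3) := if j == 0 then 0%N else (a + j)%N.
have := obs 2%N t (fun=> k) => /=.
have -> : window_word Pi t (fun=> k) (t ord0) (t ord_max - t ord0).+1 =
    [:: (col k Pi)^T] ++ nseq a (const_mx 1) ++ [:: (col k Pi)^T; (col k Pi)^T].
  have -> : t ord0 = 0%N by [].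
  have -> : (t ord_max - 0).+1 = (1 + (a + 2))%N by rewrite /t /=; lia.
  rewrite /window_word !iotaD !map_cat add0n; congr (_ ++ _ ++ _).
  - by rewrite /= -[0%N]/(t 0) emission_constraint.
  - apply: (@eq_from_nth _ 0) => [|u];
      rewrite size_map size_iota ?size_nseq // => ua.
    rewrite (nth_map 0%N) ?size_iota // nth_iota // nth_nseq ua.
    apply: emission_unconstrained => j; rewrite /t -(inj_eq val_inj) /=.
    by case: (nat_of_ord j) => [|m] /=; lia.
  - rewrite /=; have -> : (1 + a)%N = t 1 by rewrite /t /= addnC.
    have -> : (t 1).+1 = t 2%:R by rewrite /t /=; lia.
    by rewrite !emission_constraint.
apply=> i j; rewrite /t -!(inj_eq val_inj) /=.
by case: (nat_of_ord i) (nat_of_ord j) => [|p] [|q] //=; lia.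
Qed.

End Main.

Theorem theorem4p4 (d : measure_display) (T : measurableType d) (R : realType)
    (Pr : probability T R) (K : nat)
    (P : 'M[R]_3) (mu : 'rV[R]_3) (Pi : 'M[R]_(3, K))
    (C : nat -> T -> 'I_3) (S : nat -> T -> 'I_K)
    (hmm : hidden_markov_model Pr P mu Pi C S) :
  ~ observed_reversible Pr S <->
  [/\ ~ chain_reversible P mu,
      regular_emission Pi
    & \rank Pi = 3%N \/ (\rank Pi = 2%N /\ ~~ eigenvalue P 0)].
Proof.
split=> [irr|[irr reg cond] obs]; last first.
  apply: irr; case: cond => [rk|[rk P0]].
    exact: (chain_reversible_rank3 hmm).
  exact: (chain_reversible_rank2 hmm).
have reg : regular_emission Pi.
  move=> i j ij rows; apply: irr.
  exact: (observed_reversible_singular hmm ij).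
split=> //; first by move=> /(observed_reversible_chain hmm).
have [rk1|] := leqP (\rank Pi) 1.
  case: (reg 0 1) => //.
  exact: (rank1_singular (hmm_emission_stochastic hmm)).
rewrite leq_eqVlt => /orP[/eqP rk2|rk3]; last first.
  by left; apply/eqP; rewrite eqn_leq rk3 rank_leq_row.
right; split=> //; apply/negP => P0; apply: irr.
exact: (observed_reversible_eigen0 hmm).
Qed.
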